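(* Let $a_c\in(0,\pi)$ be the angle with $$\cos(a_c)=-1+\frac12\left(\left(1+\frac{\sqrt{78}}{9}\right)^{1/3}+\left(1-\frac{\sqrt{78}}{9}\right)^{1/3}\right),$$ so that $a_c=1.8124\ldots$. For every $a_\ell\in(\pi/2,a_c)$ there exist two scalene shapes whose largest arc angle is $a_\ell$ and which are shapes of relative equilibria on a rotating meridian. That is, there exist two distinct values $x\in(0,a_\ell)$ with $x\neq a_\ell/2$ such that the shape $(\theta_{21},\theta_{31})=(a_\ell,x)$ (whose three arc angles $a_\ell$, $x$, $a_\ell-x$ are pairwise different, with $a_\ell$ the largest) is a rigid rotator.
   Context: Three bodies of equal mass $1$ lie on a rotating meridian (a great circle through the poles, rotating about the $z$-axis with constant angular velocity $\omega$) of the unit sphere $\mathbb{S}^2$, and interact through the cotangent potential. The position of body $k\in\{1,2,3\}$ on the meridian is the signed angle $\theta_k$ (modulo $2\pi$) from the north pole; write $\theta_{ij}=\theta_i-\theta_j$. It is assumed that no two bodies coincide or are antipodal, i.e. $\sin\theta_{ij}\ne 0$ for $i\neq j$. A configuration $(\theta_1,\theta_2,\theta_3)$ is a relative equilibrium on a rotating meridian with angular velocity $\omega\in\mathbb{R}$ if it satisfies the equations of motion $$\frac{\omega^2}{2}\sin(2\theta_k)=\sum_{i\ne k}\frac{\sin(\theta_k-\theta_i)}{|\sin(\theta_k-\theta_i)|^3},\qquad k=1,2,3.$$ A shape is the pair of mutual angles $(\theta_{21},\theta_{31})$. A shape is called a rigid rotator (it satisfies the equations of motion) if there exist $\theta_1\in\mathbb{R}$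 and $\omega\in\mathbb{R}$ such that $(\theta_1,\theta_1+\theta_{21},\theta_1+\theta_{31})$ is a relative equilibrium with angular velocity $\omega$. The arc angle between two bodies is their angular distance in $[0,\pi]$ along the meridian circle. A shape is scalene if its three arc angles are pairwise different. *)

(* Defs.v *)
From Stdlib Require Import Reals.
Open Scope R_scope.

(* Force, along the meridian, exerted by a unit mass on another one whose signed
   angle relative to it is t (cotangent potential). Meaningful for sin t <> 0. *)
Definition force (t : R) : R := sin t / Rabs (sin t) ^ 3.

(* t1, t2, t3 are signed angles from the north pole, as real representatives
   modulo 2 PI. *)
Definition relative_equilibrium (omega t1 t2 t3 : R) : Prop :=
  (sin (t1 - t2) <> 0 /\ sin (t1 - t3) <> 0 /\ sin (t2 - t3) <> 0) /\
  omega ^ 2 / 2 * sin (2 * t1) = force (t1 - t2) + force (t1 - t3) /\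
  omega ^ 2 / 2 * sin (2 * t2) = force (t2 - t1) + force (t2 - t3) /\
  omega ^ 2 / 2 * sin (2 * t3) = force (t3 - t1) + force (t3 - t2).

(* The pair (theta_21, theta_31), where theta_ij = theta_i - theta_j. *)
Definition shape : Type := (R * R)%type.

Definition rigid_rotator (s : shape) : Prop :=
  exists t1 omega : R,
    relative_equilibrium omega t1 (t1 + fst s) (t1 + snd s).

(* Angular distance in [0, PI] between two points of the circle whose signed
   angles differ by t. *)
Definition arc_angle (t : R) : R := acos (cos t).

Definition arc21 (s : shape) : R := arc_angle (fst s).
Definition arc31 (s : shape) : R := arc_angle (snd s).
Definition arc23 (s : shape) : R := arc_angle (fst s - snd s).

Definition scalene (s : shape) : Prop :=
  arc21 s <> arc31 s /\ arc21 s <> arc23 s /\ arc31 s <> arc23 s.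

Definition largest_arc (s : shape) : R :=
  Rmax (arc21 s) (Rmax (arc31 s) (arc23 s)).

(* Both radicands are positive, so Rpower _ (1/3) is the real cube root. *)
Definition cos_ac : R :=
  -1 + 1 / 2 * (Rpower (1 + sqrt 78 / 9) (1 / 3) +
                Rpower (1 - sqrt 78 / 9) (1 / 3)).

Definition a_c : R := acos cos_ac.

(* Main.v *)
Require Import Defs.
From Stdlib Require Import Reals.
From Stdlib Require Import Lra.
Open Scope R_scope.

(** Adding the three equations of motion kills the forces, so for bodies at
    angles t, t + a, t + x on a rotating meridian the complex number
    exp(2it) (1 + exp(2ia) + exp(2ix)) has to be real. If the second factor is
    nonzero, this fixes t up to quarter turns, and a quarter turn changes the
    sign of all three left-hand sides. The only condition left on the shape
    (a, x) is the proportionality of two force sums to two sums of sines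
    ([rigid_rotator_of_shape_equation]).

    With u = x and v = a - x that condition is antisymmetric in u and v. Besides
    the factor sin (u - v) of the isosceles shapes it contains a polynomial of
    degree two in z = cos (u - v), with coefficients depending on c = cos a
    ([shape_equation_of_quadratic_root]). Only z enters, so a root gives the two
    mirror-image solutions u - v = acos z and u - v = - acos z. Both arcs are
    positive and distinct exactly when c < z < 1.

    The polynomial is negative at z = c when c < 0. At z = 1 it has the sign of
    4 w^3 - w - 1 with w = c + 1. Cardano's formula identifies cos_ac + 1 as the
    real root of this cubic ([cos_ac_cubic]), so a < a_c is what makes the value
    at 1 positive, and the intermediate value theorem gives z. *)

(** * Relative equilibria and the shape equation *)

Lemma force_of_sin_pos (t : R) : 0 < sin t -> force t = / (sin t) ^ 2.
Proof.
  intros Ht; unfold force.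
  rewrite Rabs_pos_eq by lra. field; lra.
Qed.

Lemma force_opp (t : R) : force (- t) = - force t.
Proof.
  unfold force. rewrite sin_neg, Rabs_Ropp. unfold Rdiv; ring.
Qed.

Lemma polar_form (u v : R) :
  exists r phi : R, 0 <= r /\ r * cos phi = u /\ r * sin phi = v.
Proof.
  set (r := sqrt (u² + v²)).
  assert (Hr2 : r * r = u² + v²)
    by (apply sqrt_sqrt; apply Rplus_le_le_0_compat; apply Rle_0_sqr).
  assert (Hr : 0 <= r) by apply sqrt_pos.
  unfold Rsqr in Hr2.
  destruct (Req_dec r 0) as [H0 | H0].
  { exists 0, 0. rewrite H0 in Hr2. repeat split; nra. }
  assert (Hb : -1 <= u / r <= 1).
  { assert (- r <= u <= r) by (split; nra).
    split; apply Rmult_le_reg_r with r; try lra;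
      replace (u / r * r) with u by (field; exact H0); lra. }
  assert (Hs : r * sin (acos (u / r)) = Rabs v).
  { rewrite sin_acos by exact Hb.
    assert (E : 1 - (u / r)² = (v / r)²).
    { unfold Rsqr. replace (v / r * (v / r)) with ((r * r - u * u) / (r * r)).
      - field; exact H0.
      - rewrite Hr2. replace (u * u + v * v - u * u) with (v * v) by ring.
        rewrite <- Hr2. field; exact H0. }
    rewrite E, sqrt_Rsqr_abs. unfold Rdiv. rewrite Rabs_mult.
    rewrite (Rabs_pos_eq (/ r)).
    - field; exact H0.
    - apply Rlt_le, Rinv_0_lt_compat; lra. }
  assert (Hc : r * cos (acos (u / r)) = u)
    by (rewrite cos_acos by exact Hb; field; exact H0).
  destruct (Rle_dec 0 v) as [Hv | Hv].
  - exists r, (acos (u / r)). rewrite Rabs_pos_eq in Hs by exact Hv. tauto.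
  - exists r, (- acos (u / r)). rewrite cos_neg, sin_neg.
    rewrite Rabs_left in Hs by lra. repeat split; lra.
Qed.

(** The equations of motion prescribe omega^2/2 times the sine of each doubled
    angle. The prescribed values are the second coordinates of one vector
    k (Sx, -D) rotated by 0, 2a and 2x, where (Sx, D) is the sum of the unit
    vectors at angles 0, 2a and 2x, and k is the common ratio provided by the
    shape equation. Polar coordinates of this vector, for either sign of k, are
    omega^2/2 and twice the angle of the first body. *)
Lemma rigid_rotator_of_shape_equation (a x : R) :
  0 < sin a -> 0 < sin x -> 0 < sin (a - x) ->
  sin (2 * a) + sin (2 * x) <> 0 ->
  (sin (2 * a) + sin (2 * x)) * (/ sin a ^ 2 + / sin (a - x) ^ 2) =
  (sin (2 * a) + sin (2 * (a - x))) * (/ sin a ^ 2 + / sin x ^ 2) ->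
  rigid_rotator (a, x).
Proof.
  intros Ha Hx Hax HD Heq.
  set (D := sin (2 * a) + sin (2 * x)) in *.
  (* The ratio of force sum to sine sum, common to the first two bodies. *)
  set (k := (/ sin a ^ 2 + / sin x ^ 2) / D).
  assert (HkD : k * D = / sin a ^ 2 + / sin x ^ 2) by (unfold k; field; lra).
  assert (HkE : k * (sin (2 * a) + sin (2 * (a - x)))
                = / sin a ^ 2 + / sin (a - x) ^ 2).
  { apply Rmult_eq_reg_l with D; [| exact HD].
    rewrite Heq, <- HkD. ring. }
  destruct (polar_form (k * (1 + cos (2 * a) + cos (2 * x))) (- (k * D)))
    as (r & phi & Hr & Hcos & Hsin).
  exists (phi / 2), (sqrt (2 * r)). simpl fst; simpl snd.
  assert (Hw : sqrt (2 * r) ^ 2 / 2 = r) by (rewrite pow2_sqrt by lra; lra).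
  unfold relative_equilibrium. rewrite Hw.
  replace (2 * (phi / 2)) with phi by lra.
  replace (2 * (phi / 2 + a)) with (phi + 2 * a) by lra.
  replace (2 * (phi / 2 + x)) with (phi + 2 * x) by lra.
  replace (phi / 2 - (phi / 2 + a)) with (- a) by lra.
  replace (phi / 2 - (phi / 2 + x)) with (- x) by lra.
  replace (phi / 2 + a - (phi / 2 + x)) with (a - x) by lra.
  replace (phi / 2 + a - phi / 2) with a by lra.
  replace (phi / 2 + x - phi / 2) with x by lra.
  replace (phi / 2 + x - (phi / 2 + a)) with (- (a - x)) by lra.
  rewrite !force_opp, !force_of_sin_pos, !sin_neg by assumption.
  assert (Hrot : forall b, r * sin (phi + b)
      = k * ((1 + cos (2 * a) + cos (2 * x)) * sin b - D * cos b)).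
  { intros b. rewrite sin_plus.
    replace (r * (sin phi * cos b + cos phi * sin b))
      with (r * sin phi * cos b + r * cos phi * sin b) by ring.
    rewrite Hsin, Hcos. ring. }
  rewrite !Hrot.
  replace (2 * (a - x)) with (2 * a - 2 * x) in HkE by ring.
  rewrite sin_minus in HkE.
  assert (Ca : sin (2 * a) ^ 2 + cos (2 * a) ^ 2 = 1)
    by (rewrite <- !Rsqr_pow2; apply sin2_cos2).
  assert (Cx : sin (2 * x) ^ 2 + cos (2 * x) ^ 2 = 1)
    by (rewrite <- !Rsqr_pow2; apply sin2_cos2).
  repeat split; try lra; unfold D in *; nra.
Qed.

(** * The quadratic equation for scalene shapes *)

(** The cofactor of sin (u - v) / (sin u sin v)^2 in the shape equation, for
    c = cos (u + v) and z = cos (u - v). *)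
Definition scalene_quadratic (c z : R) : R :=
  c / (2 * (1 - c ^ 2)) * (z - c) ^ 2 + (1 - 2 * c ^ 2) * z
  + 2 * c * (1 - c ^ 2) + c.

(** All functions of u and v are rewritten through half-sum and half-difference
    identities: the product and the sum of squares of sin u and sin v depend on
    c and z only, while the difference of squares carries the factor
    sin (u - v). *)
Lemma shape_equation_of_quadratic_root (u v : R) :
  0 < sin u -> 0 < sin v -> 0 < sin (u + v) ->
  scalene_quadratic (cos (u + v)) (cos (u - v)) = 0 ->
  (sin (2 * (u + v)) + sin (2 * u)) * (/ sin (u + v) ^ 2 + / sin v ^ 2) =
  (sin (2 * (u + v)) + sin (2 * v)) * (/ sin (u + v) ^ 2 + / sin u ^ 2).
Proof.
  intros Hu Hv Huv HQ.
  set (s := sin (u + v)) in *. set (c := cos (u + v)) in *.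
  set (z := cos (u - v)) in *. set (t := sin (u - v)).
  assert (E2 : sin (2 * (u + v)) = 2 * s * c) by apply sin_2a.
  assert (Eu : sin (2 * u) = s * z + c * t).
  { replace (2 * u) with ((u + v) + (u - v)) by ring. apply sin_plus. }
  assert (Ev : sin (2 * v) = s * z - c * t).
  { replace (2 * v) with ((u + v) - (u - v)) by ring. apply sin_minus. }
  assert (Cu : sin u ^ 2 + cos u ^ 2 = 1)
    by (rewrite <- !Rsqr_pow2; apply sin2_cos2).
  assert (Cv : sin v ^ 2 + cos v ^ 2 = 1)
    by (rewrite <- !Rsqr_pow2; apply sin2_cos2).
  assert (Cs : s ^ 2 = 1 - c ^ 2).
  { pose proof (sin2_cos2 (u + v)) as H. rewrite !Rsqr_pow2 in H.
    fold s c in H. lra. }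
  assert (P : sin u * sin v = (z - c) / 2)
    by (unfold z, c; rewrite cos_minus, cos_plus; lra).
  assert (Sm : sin u ^ 2 + sin v ^ 2 = 1 - c * z)
    by (unfold z, c; rewrite cos_minus, cos_plus; nra).
  assert (Df : sin u ^ 2 - sin v ^ 2 = s * t)
    by (unfold s, t; rewrite sin_minus, sin_plus; nra).
  rewrite E2, Eu, Ev.
  set (U := sin u) in *. set (V := sin v) in *.
  assert (K : (2 * s * c + (s * z + c * t)) * (/ s ^ 2 + / V ^ 2)
     - (2 * s * c + (s * z - c * t)) * (/ s ^ 2 + / U ^ 2)
     = ((2 * s * c + s * z) * (U ^ 2 - V ^ 2)
        + c * t * (2 * (U * V) ^ 2 / s ^ 2 + (U ^ 2 + V ^ 2))) / (U * V) ^ 2)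
    by (field; repeat split; lra).
  apply Rminus_diag_uniq. rewrite K, Df, Sm, P.
  replace ((2 * s * c + s * z) * (s * t) + c * t *
    (2 * ((z - c) / 2) ^ 2 / s ^ 2 + (1 - c * z)))
    with (t * (s ^ 2 * (2 * c + z) + c *
    (2 * ((z - c) / 2) ^ 2 / s ^ 2 + (1 - c * z)))) by ring.
  assert (Hc : 1 - c ^ 2 <> 0) by (rewrite <- Cs; apply pow_nonzero; lra).
  rewrite Cs.
  replace ((1 - c ^ 2) * (2 * c + z) + c *
    (2 * ((z - c) / 2) ^ 2 / (1 - c ^ 2) + (1 - c * z)))
    with (scalene_quadratic c z)
    by (unfold scalene_quadratic; field; exact Hc).
  rewrite HQ. unfold Rdiv; ring.
Qed.

(** The shape equation degenerates when both sums of sines vanish. Their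
    difference is 2 cos (u + v) sin (u - v), which is nonzero for an obtuse
    u + v and distinct u, v. *)
Lemma rigid_rotator_scalene (u v : R) :
  0 < u -> 0 < v -> PI / 2 < u + v < PI -> u <> v ->
  scalene_quadratic (cos (u + v)) (cos (u - v)) = 0 ->
  rigid_rotator (u + v, u).
Proof.
  intros Hu Hv Huv Hne HQ.
  assert (Su : 0 < sin u) by (apply sin_gt_0; lra).
  assert (Sv : 0 < sin v) by (apply sin_gt_0; lra).
  assert (Suv : 0 < sin (u + v)) by (apply sin_gt_0; lra).
  pose proof (shape_equation_of_quadratic_root u v Su Sv Suv HQ) as E.
  apply rigid_rotator_of_shape_equation;
    try replace (u + v - u) with v by ring; try assumption.
  intros HD.
  assert (PA : 0 < / sin (u + v) ^ 2) by (apply Rinv_0_lt_compat, pow_lt, Suv).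
  assert (PU : 0 < / sin u ^ 2) by (apply Rinv_0_lt_compat, pow_lt, Su).
  assert (HE : sin (2 * (u + v)) + sin (2 * v) = 0).
  { rewrite HD, Rmult_0_l in E. symmetry in E.
    apply Rmult_integral in E. destruct E; lra. }
  assert (Hprod : cos (u + v) * sin (u - v) = 0).
  { assert (F : sin (2 * u) - sin (2 * v) = 0) by lra.
    rewrite form4 in F.
    replace ((2 * u - 2 * v) / 2) with (u - v) in F by field.
    replace ((2 * u + 2 * v) / 2) with (u + v) in F by field. lra. }
  assert (Hc : cos (u + v) < 0) by (apply cos_lt_0; lra).
  apply Rmult_integral in Hprod. destruct Hprod as [H | H]; [lra |].
  destruct (Rdichotomy _ _ Hne) as [L | L].
  - assert (0 < sin (v - u)) by (apply sin_gt_0; lra).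
    replace (u - v) with (- (v - u)) in H by ring. rewrite sin_neg in H. lra.
  - assert (0 < sin (u - v)) by (apply sin_gt_0; lra). lra.
Qed.

(** * The critical angle *)

(** Cardano: the cube roots p, q satisfy p^3 + q^3 = 2 and p q = 1/3, because
    (1 + sqrt 78 / 9) (1 - sqrt 78 / 9) = 1/27. *)
Lemma cos_ac_cubic : 4 * (cos_ac + 1) ^ 3 = (cos_ac + 1) + 1.
Proof.
  unfold cos_ac.
  assert (Hs0 : 0 <= sqrt 78) by apply sqrt_pos.
  assert (Hs : sqrt 78 * sqrt 78 = 78) by (apply sqrt_sqrt; lra).
  assert (Hs9 : sqrt 78 < 9) by nra.
  set (p := Rpower (1 + sqrt 78 / 9) (1 / 3)).
  set (q := Rpower (1 - sqrt 78 / 9) (1 / 3)).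
  assert (cube : forall y, 0 < y -> Rpower y (1 / 3) ^ 3 = y).
  { intros y Hy. rewrite <- Rpower_pow by apply exp_pos.
    rewrite Rpower_mult. replace (1 / 3 * INR 3) with 1 by (simpl; field).
    apply Rpower_1, Hy. }
  assert (Hp : p ^ 3 = 1 + sqrt 78 / 9) by (apply cube; lra).
  assert (Hq : q ^ 3 = 1 - sqrt 78 / 9) by (apply cube; lra).
  assert (Hpq : p * q = 1 / 3).
  { unfold p, q. rewrite Rpower_mult_distr by lra.
    replace ((1 + sqrt 78 / 9) * (1 - sqrt 78 / 9)) with ((1 / 3) ^ 3) by lra.
    rewrite <- Rpower_pow, Rpower_mult by lra.
    replace (INR 3 * (1 / 3)) with 1 by (simpl; field).
    apply Rpower_1; lra. }
  replace (4 * (-1 + 1 / 2 * (p + q) + 1) ^ 3)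
    with (1 / 2 * (p ^ 3 + q ^ 3) + 3 / 2 * (p * q) * (p + q)) by field.
  rewrite Hp, Hq, Hpq. field.
Qed.

(** A positive root of 4 u^3 = u + 1 has u > 1/2, where the cubic is increasing,
    so its signs at the endpoints locate the root. *)
Lemma cos_ac_bounds : - 0.23935 < cos_ac < - 0.2393.
Proof.
  assert (H : 4 * (cos_ac + 1) ^ 3 = cos_ac + 1 + 1) by apply cos_ac_cubic.
  assert (Hpos : 0 < cos_ac + 1).
  { unfold cos_ac, Rpower.
    pose proof (exp_pos (1 / 3 * ln (1 + sqrt 78 / 9))).
    pose proof (exp_pos (1 / 3 * ln (1 - sqrt 78 / 9))). lra. }
  set (u := cos_ac + 1) in *.
  assert (0.76065 < u < 0.7607); [| unfold u in *; lra].
  assert (1 <= 2 * u) by nra.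
  split; apply Rnot_le_lt; intros Hle; nra.
Qed.

(** The cubic 4 w^3 - w - 1 vanishes at u = cos_ac + 1, and its quotient by
    w - u is positive for w > u > 3/4. *)
Lemma quadratic_pos_at_one (c : R) :
  cos_ac < c < 0 -> 0 < scalene_quadratic c 1.
Proof.
  intros Hc.
  pose proof cos_ac_bounds as Hb. pose proof cos_ac_cubic as H.
  unfold scalene_quadratic.
  replace (c / (2 * (1 - c ^ 2)) * (1 - c) ^ 2 + (1 - 2 * c ^ 2) * 1
    + 2 * c * (1 - c ^ 2) + c)
    with ((1 - c) * (4 * (c + 1) ^ 3 - (c + 1) - 1) / (2 * (1 + c)))
    by (field; split; nra).
  apply Rdiv_lt_0_compat; [| lra].
  apply Rmult_lt_0_compat; [lra |].
  set (w := c + 1). set (u := cos_ac + 1) in *.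
  replace (4 * w ^ 3 - w - 1)
    with ((w - u) * (4 * (w ^ 2 + w * u + u ^ 2) - 1)
          + (4 * u ^ 3 - (u + 1))) by ring.
  rewrite H.
  assert (3 / 4 < u < w) by (unfold u, w; lra).
  assert (0 < (w - u) * (4 * (w ^ 2 + w * u + u ^ 2) - 1))
    by (apply Rmult_lt_0_compat; nra).
  lra.
Qed.

Lemma quadratic_root (c : R) :
  cos_ac < c < 0 -> exists z, c < z < 1 /\ scalene_quadratic c z = 0.
Proof.
  intros Hc.
  pose proof cos_ac_bounds as Hb.
  pose proof (quadratic_pos_at_one c Hc) as H1.
  assert (H0 : scalene_quadratic c c < 0).
  { unfold scalene_quadratic.
    replace (c / (2 * (1 - c ^ 2)) * (c - c) ^ 2 + (1 - 2 * c ^ 2) * c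
    + 2 * c * (1 - c ^ 2) + c) with (c * (4 * (1 - c ^ 2)))
    by (field; nra). nra. }
  assert (Hcont : continuity (scalene_quadratic c)).
  { unfold scalene_quadratic. reg. }
  destruct (IVT (scalene_quadratic c) c 1 Hcont ltac:(lra) H0 H1)
    as (z & Hz & E).
  exists z. split; [| exact E].
  split; apply Rnot_le_lt; intros Hle.
  - replace z with c in E by lra. lra.
  - replace z with 1 in E by lra. lra.
Qed.

(** * Numerical location of the critical angle *)

Lemma INR_fact_S (n : nat) : INR (Factorial.fact (S n)) = INR (S n) * INR (Factorial.fact n).
Proof. rewrite fact_simpl; apply mult_INR. Qed.

Lemma cos_taylor_bounds (t : R) : -2 <= t <= 2 ->
  1 - t ^ 2 / 2 + t ^ 4 / 24 - t ^ 6 / 720 + t ^ 8 / 40320 - t ^ 10 / 3628800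
  <= cos t <=
  1 - t ^ 2 / 2 + t ^ 4 / 24 - t ^ 6 / 720 + t ^ 8 / 40320 - t ^ 10 / 3628800
  + t ^ 12 / 479001600.
Proof.
  intros Ht.
  (* Near 1.8125 the two bounds differ by less than 3e-6, which suffices because
     the bounds on cos_ac leave a margin of 7e-6. *)
  destruct (pre_cos_bound t 2 (proj1 Ht) (proj2 Ht)) as [L U].
  unfold cos_approx, cos_term in L, U.
  cbn [sum_f_R0 Nat.mul Nat.add] in L, U.
  rewrite !INR_fact_S, !INR_IZR_INZ in L.
  rewrite !INR_fact_S, !INR_IZR_INZ in U.
  cbn [Z.of_nat Pos.of_succ_nat Pos.succ Factorial.fact] in L, U.
  lra.
Qed.

Lemma a_c_bounds :
  0 < a_c < PI /\ cos a_c = cos_ac /\ 1.8124 <= a_c < 1.8125.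
Proof.
  pose proof cos_ac_bounds as Hb.
  assert (Hcos : cos a_c = cos_ac) by (apply cos_acos; lra).
  assert (Hr : 0 < a_c < PI) by (apply acos_bound_lt; lra).
  assert (HPI : 3 < PI) by (pose proof PI2_3_2; lra).
  pose proof (cos_taylor_bounds 1.8124 ltac:(lra)) as T1.
  pose proof (cos_taylor_bounds 1.8125 ltac:(lra)) as T2.
  split; [exact Hr | split; [exact Hcos | split]].
  - apply Rlt_le, cos_decreasing_0; lra.
  - apply cos_decreasing_0; lra.
Qed.

(** * Two scalene rigid rotators *)

Lemma arc_angle_id (t : R) : 0 <= t <= PI -> arc_angle t = t.
Proof. apply acos_cos. Qed.

Theorem mainTheorem1 :
  (0 < a_c < PI /\ cos a_c = cos_ac /\ 1.8124 <= a_c < 1.8125) /\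
  forall a_l : R, PI / 2 < a_l < a_c ->
    exists x1 x2 : R, x1 <> x2 /\
      forall x : R, x = x1 \/ x = x2 ->
        0 < x < a_l /\ x <> a_l / 2 /\
        (arc21 (a_l, x) = a_l /\ arc31 (a_l, x) = x /\
         arc23 (a_l, x) = a_l - x) /\
        scalene (a_l, x) /\ largest_arc (a_l, x) = a_l /\
        rigid_rotator (a_l, x).
Proof.
  split; [exact a_c_bounds |].
  intros a Ha.
  destruct a_c_bounds as (Hac & Hcos & _).
  assert (HPI : 0 < PI) by apply PI_RGT_0.
  assert (Hc : cos_ac < cos a < 0).
  { split.
    - rewrite <- Hcos. apply cos_decreasing_1; lra.
    - apply cos_lt_0; lra. }
  pose proof cos_ac_bounds as Hb.
  destruct (quadratic_root (cos a) Hc) as (z & Hz & HQ).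
  set (d := acos z).
  assert (Hd : cos d = z) by (apply cos_acos; lra).
  assert (Hd0 : 0 < d < PI) by (apply acos_bound_lt; lra).
  assert (Hda : d < a) by (apply cos_decreasing_0; lra).
  exists ((a + d) / 2), ((a - d) / 2). split; [lra |].
  intros x Hx.
  assert (Hx0 : 0 < x < a) by lra.
  assert (Hxn : x <> a / 2) by lra.
  assert (Hcd : cos (x - (a - x)) = z).
  { destruct Hx as [-> | ->].
    - replace ((a + d) / 2 - (a - (a + d) / 2)) with d by field. exact Hd.
    - replace ((a - d) / 2 - (a - (a - d) / 2)) with (- d) by field.
      rewrite cos_neg. exact Hd. }
  assert (A21 : arc21 (a, x) = a) by (apply arc_angle_id; simpl; lra).
  assert (A31 : arc31 (a, x) = x) by (apply arc_angle_id; simpl; lra).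
  assert (A23 : arc23 (a, x) = a - x) by (apply arc_angle_id; simpl; lra).
  unfold scalene, largest_arc. rewrite A21, A31, A23.
  repeat split; try lra.
  - apply Rmax_left, Rmax_lub; lra.
  - replace (a, x) with (x + (a - x), x) by (f_equal; ring).
    apply rigid_rotator_scalene; try lra.
    replace (x + (a - x)) with a by ring. rewrite Hcd. exact HQ.
Qed.
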